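(* If $G$ is a graph and $t\geq 2$, then $\iota(S_G^t) \geq \iota(S_G^2|Ex(S_G^2))\cdot n(G)^{t-2}$.
   Context: All graphs are finite and simple, $n(G)=|V(G)|$. For a graph $G=(V,E)$ and integer $t\ge1$, the generalized Sierpiński graph $S_G^t$ has vertex set $V^t$ (words $u_1\ldots u_t$), and $u=u_1\ldots u_t$, $v=v_1\ldots v_t$ are adjacent iff there is $i\in[t]$ with $u_j=v_j$ for $j<i$, $u_i\ne v_i$ and $u_iv_i\in E$, and $u_j=v_i$, $v_j=u_i$ for all $j>i$. The vertices $xx\ldots x$ are the extreme vertices; $Ex(S_G^t)$ denotes their set. A set $A$ of vertices is isolating if no two vertices outside the closed neighborhood $N[A]$ are adjacent; $\iota$ is the minimum size of an isolating set. For a graph $F$ and $X\subseteq V(F)$, $F|X$ denotes $F$ with the vertices of $X$ considered already dominated: $\iota(F|X)$ is the minimum size of a set $D\subseteq V(F)$ such that no two vertices of $V(F)-(N[D]\cup X)$ are adjacent. *)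

(* Defs.v *)
From mathcomp Require Import all_boot.

Set Implicit Arguments.
Unset Strict Implicit.
Unset Printing Implicit Defensive.

Record sgraph := SGraph {
  vertex :> finType;
  adj : rel vertex;
  adj_sym : symmetric adj;
  adj_irrefl : irreflexive adj
}.

Section Isolation.
Variable F : sgraph.
Implicit Types A D X : {set F}.

Definition closed_nbhd A : {set F} :=
  A :|: [set v | [exists u in A, adj u v]].

Definition isolating A : bool :=
  [forall x, forall y,
    (x \notin closed_nbhd A) && (y \notin closed_nbhd A) ==> ~~ adj x y].

Definition isolating_rel X D : bool :=
  [forall x, forall y,
    (x \notin closed_nbhd D :|: X) && (y \notin closed_nbhd D :|: X)
      ==> ~~ adj x y].

(* The default setT satisfies both predicates (see the two lemmas below), so
   each arg min is a genuine minimum. *)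
Definition iota_num : nat :=
  #|[arg min_(A < [set: F] | isolating A) #|A| ]|.

Definition iota_rel X : nat :=
  #|[arg min_(D < [set: F] | isolating_rel X D) #|D| ]|.

Lemma isolatingT : isolating [set: F].
Proof. by apply/forallP=> x; apply/forallP=> y; rewrite !inE. Qed.

Lemma isolating_relT X : isolating_rel X [set: F].
Proof. by apply/forallP=> x; apply/forallP=> y; rewrite !inE. Qed.

End Isolation.

Section Sierpinski.
Variables (G : sgraph) (t : nat).

Definition sierpinski_adj : rel (t.-tuple G) := fun u v =>
  [exists i : 'I_t,
    [&& [forall j : 'I_t, (j < i) ==> (tnth u j == tnth v j)],
        tnth u i != tnth v i,
        adj (tnth u i) (tnth v i)
      & [forall j : 'I_t, (i < j) ==>
           (tnth u j == tnth v i) && (tnth v j == tnth u i)]]].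

Lemma sierpinski_adj_sym : symmetric sierpinski_adj.
Proof.
move=> u v; apply: eq_existsb => i.
rewrite (eq_sym (tnth u i)) adj_sym; congr [&& _, _, _ & _].
  by apply: eq_forallb => j; rewrite eq_sym.
by apply: eq_forallb => j; rewrite andbC.
Qed.

Lemma sierpinski_adj_irrefl : irreflexive sierpinski_adj.
Proof. by move=> u; apply/existsP=> -[i /and4P[_ /eqP]]. Qed.

Definition sierpinski : sgraph :=
  SGraph sierpinski_adj_sym sierpinski_adj_irrefl.

Definition extreme : {set sierpinski} :=
  [set (nseq_tuple t x : sierpinski) | x in [set: G]].

End Sierpinski.

(* Main.v *)
Require Import Defs.
From mathcomp Require Import all_boot.

(** Every prefix [w] of length [t - 2] spans a copy [w S_G^2] of [S_G^2] in
    [S_G^t], and these copies partition the vertices. Only the extreme vertices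
    of a copy have neighbours outside it, so the trace of an isolating set on
    each copy is isolating relative to the extreme vertices. *)

Lemma iota_rel_min (F : sgraph) (X D : {set F}) :
  isolating_rel X D -> iota_rel X <= #|D|.
Proof.
rewrite /iota_rel => isoD.
by case: arg_minnP => [|E _ minE]; [exact: isolating_relT | exact: minE].
Qed.

Lemma iota_num_witness (F : sgraph) :
  exists2 A : {set F}, isolating A & #|A| = iota_num F.
Proof.
rewrite /iota_num; case: arg_minnP => [|A isoA _]; first exact: isolatingT.
by exists A.
Qed.

Section Copies.
Variables (G : sgraph) (k m : nat).
Implicit Types (w : k.-tuple G) (x y : m.-tuple G) (u : (k + m).-tuple G).

Lemma cat_tuple_inj w w' x x' :
  cat_tuple w x = cat_tuple w' x' -> (w, x) = (w', x').
Proof.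
move=> /(congr1 val) /eqP /=; rewrite eqseq_cat ?size_tuple //.
by case/andP=> /eqP/val_inj-> /eqP/val_inj->.
Qed.

(** Words sharing the prefix [w] can first differ only in the suffix, so each copy is an induced
    subgraph. *)
Lemma sierpinski_adj_cat w x y :
  sierpinski_adj (cat_tuple w x) (cat_tuple w y) = sierpinski_adj x y.
Proof.
apply/existsP/existsP => -[i /and4P[/forallP eqlt neqi adji /forallP eqgt]].
- case: (split_ordP i) => i' def_i; subst i.
    by rewrite !tnth_lshift eqxx in neqi.
  rewrite !tnth_rshift in neqi adji eqgt.
  exists i'; apply/and4P; split=> //; apply/forallP=> j.
    by have := eqlt (rshift k j); rewrite !tnth_rshift /= ltn_add2l.
  by have := eqgt (rshift k j); rewrite !tnth_rshift /= ltn_add2l.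
- exists (rshift k i); rewrite !tnth_rshift neqi adji /=.
  apply/andP; split; apply/forallP=> j; case: (split_ordP j) => j' ->;
    rewrite ?tnth_lshift ?tnth_rshift /= ?eqxx ?implybT ?ltn_add2l //.
  (* The remaining [j'] is a prefix index, so it cannot exceed [k + i]. *)
  by rewrite ltnNge ltnW // ltn_addr.
Qed.

(** The cases are the two places for the first differing index [i]. In the prefix, all later letters
    of the second word, hence all of [x], equal letter [i] of [u]; in the suffix, [u] still begins
    with [w]. *)
Lemma sierpinski_adj_cat_split u w x :
  sierpinski_adj u (cat_tuple w x) ->
  (exists a : G, x = nseq_tuple m a) \/ (exists y, u = cat_tuple w y).
Proof.
case/existsP=> i /and4P[/forallP eqlt _ _ /forallP eqgt].
case: (split_ordP i) => i' def_i; subst i.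
- left; exists (tnth u (lshift m i')); apply: eq_from_tnth => j.
  rewrite [RHS]tnth_nseq; have := eqgt (rshift k j).
  by rewrite tnth_rshift /= ltn_addr //= => /andP[_ /eqP].
- right; exists [tuple tnth u (rshift k j) | j < m].
  apply: eq_from_tnth => j; case: (split_ordP j) => j' ->.
    have := eqlt (lshift m j'); rewrite /= ltn_addr //= => /eqP->.
    by rewrite !tnth_lshift.
  by rewrite tnth_rshift tnth_mktuple.
Qed.

Definition copy_trace (A : {set sierpinski G (k + m)}) w :
    {set sierpinski G m} :=
  [set x : sierpinski G m | (cat_tuple w x : sierpinski G (k + m)) \in A].

Lemma closed_nbhd_copy_trace (A : {set sierpinski G (k + m)}) w x :
  cat_tuple w x \in closed_nbhd A ->
  x \in closed_nbhd (copy_trace A w) :|: extreme G m.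
Proof.
rewrite !inE => /orP[-> // | /exists_inP[u uA adj_u]].
(* A dominating neighbour outside the copy forces [x] to be extreme; one inside the copy leaves its
   suffix [y] in the trace. *)
case: (sierpinski_adj_cat_split _ _ _ adj_u) => [[a ->] | [y def_u]].
  by apply/orP; right; apply/imsetP; exists a.
apply/orP; left; apply/orP; right; apply/exists_inP.
exists (y : sierpinski G m); first by rewrite inE -def_u.
by rewrite /= -(sierpinski_adj_cat w) -def_u.
Qed.

Lemma isolating_copy_trace (A : {set sierpinski G (k + m)}) w :
  isolating A -> isolating_rel (extreme G m) (copy_trace A w).
Proof.
move=> /forallP isoA; apply/forallP=> x; apply/forallP=> y.
apply/implyP=> /andP[xN yN].
have /forallP/(_ (cat_tuple w y))/implyP := isoA (cat_tuple w x).
rewrite /= sierpinski_adj_cat; apply; apply/andP; split.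
  exact: contra (closed_nbhd_copy_trace A w x) xN.
exact: contra (closed_nbhd_copy_trace A w y) yN.
Qed.

Lemma sum_card_copy_trace (A : {set sierpinski G (k + m)}) :
  \sum_(w : k.-tuple G) #|copy_trace A w| <= #|A|.
Proof.
under eq_bigr => w _ do rewrite -sum1_card.
rewrite pair_big_dep /= sum1_card.
(* The sum now counts pairs of prefix and suffix, which concatenation embeds into [A]. *)
pose f (p : k.-tuple G * m.-tuple G) := cat_tuple p.1 p.2.
have f_inj : injective f by move=> [w x] [w' x'] /cat_tuple_inj.
rewrite -(card_image f_inj); apply/subset_leq_card/subsetP=> u.
case/imageP=> p pA ->.
by have : p.2 \in copy_trace A p.1 by []; rewrite inE.
Qed.

Lemma iota_sierpinski_ge :
  iota_rel (extreme G m) * #|G| ^ k <= iota_num (sierpinski G (k + m)).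
Proof.
have [A isoA <-] := iota_num_witness (sierpinski G (k + m)).
apply: leq_trans (sum_card_copy_trace A).
(* [#|G| ^ k] is the number of prefixes, so the bound can be checked copy by copy. *)
rewrite mulnC -card_tuple -sum_nat_const.
by apply: leq_sum => w _; apply/iota_rel_min/isolating_copy_trace.
Qed.

End Copies.

Theorem theorem5p3 (G : sgraph) (t : nat) (ht : 2 <= t) :
  iota_rel (extreme G 2) * #|G| ^ (t - 2) <= iota_num (sierpinski G t).
Proof. by have := iota_sierpinski_ge G (t - 2) 2; rewrite subnK. Qed.
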